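(* (1) There exists a subgroup of $({}^{\omega}2,+_2)$ which is Lebesgue null but not meager. (2) There exists a subgroup of $(\mathbb{R},+)$ which is Lebesgue null but not meager.
   Context: ${}^{\omega}2$ is the Cantor space of all infinite 0-1 sequences with the product topology, the product measure (the Lebesgue measure on ${}^{\omega}2$), and the group operation $+_2$ of coordinate-wise addition modulo 2. *)

(* Defs.v *)
From HB Require Import structures.
From mathcomp Require Import all_boot all_order all_algebra.
From mathcomp Require Import all_classical all_reals all_analysis.
From mathcomp Require Import zify ring lra.

Set Implicit Arguments.
Unset Strict Implicit.
Unset Printing Implicit Defensive.

Import Order.TTheory GRing.Theory Num.Theory.
Import numFieldNormedType.Exports.

Local Open Scope classical_set_scope.
Local Open Scope ring_scope.

Definition nowhere_dense (T : topologicalType) (A : set T) : Prop :=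
  interior (closure A) = set0.

Definition meager (T : topologicalType) (A : set T) : Prop :=
  exists F : (set T)^nat,
    (forall n, nowhere_dense (F n)) /\ A `<=` \bigcup_n F n.

(* Addition on the library's Z-module [bool] is [addb]. *)
HB.instance Definition _ := GRing.Zmodule.copy cantor_space (nat -> bool).

Lemma cantor_addE (x y : cantor_space) (n : nat) : (x + y) n = x n (+) y n.
Proof. by []. Qed.

(* The Cantor space with its Borel sigma-algebra. *)
Definition cantor_borel := g_sigma_algebraType (@open cantor_space).

(* Product of countably many copies of the uniform probability on [bool]; it is
   enough to constrain initial segments of coordinates, as [A i] may be [setT]. *)
Definition is_product_measure (R : realType)
    (mu : {measure set cantor_borel -> \bar R}) : Prop :=
  forall (n : nat) (A : 'I_n -> set bool),
    mu [set x : cantor_borel | forall i : 'I_n, A i (x i)] =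
    (\prod_(i < n) bernoulli_prob 2^-1 (A i))%E.

Section product_measure.

Let cylinder (s : seq bool) : set cantor_space :=
  [set x | forall i, (i < size s)%N -> x i = nth false s i].

Let cylinder_rcons s b :
  cylinder (rcons s b) = cylinder s `&` [set x | x (size s) = b].
Proof.
apply/seteqP; split => [x sx|x [sx xb] i].
  split=> [i si|/=].
    by rewrite sx ?size_rcons ?nth_rcons ?si// ltnW.
  by rewrite sx ?size_rcons// nth_rcons ltnn eqxx.
rewrite size_rcons ltnS leq_eqVlt nth_rcons => /predU1P[->|si].
  by rewrite ltnn eqxx.
by rewrite si sx.
Qed.

Let measurable_coord (k : nat) (B : set bool) :
  measurable [set x : cantor_borel | B (x k)].
Proof.
apply: sub_sigma_algebra.
have -> : [set x : cantor_space | B (x k)] =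
    (@proj _ (fun _ : nat => bool) k) @^-1` B by [].
apply: open_comp; first by move=> + _; exact: proj_continuous.
exact: discrete_open.
Qed.

Let measurable_coords n (f : 'I_n -> nat) (A : 'I_n -> set bool) :
  measurable [set x : cantor_borel | forall i, A i (x (f i))].
Proof.
have -> : [set x : cantor_borel | forall i, A i (x (f i))] =
    \bigcap_(i in setT) [set x : cantor_borel | A i (x (f i))].
  by apply/seteqP; split=> [x Ax i _|x Ax i]; exact: Ax.
by apply: fin_bigcap_measurable => // i _; exact: measurable_coord.
Qed.

Let cylinderE s : cylinder s =
  [set x : cantor_space | forall i : 'I_(size s), [set nth false s i] (x i)].
Proof.
by apply/seteqP; split=> [x sx i|x sx i si]; [exact: sx|exact: (sx (Ordinal si))].
Qed.

Let measurable_cylinder s : measurable (cylinder s : set cantor_borel).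
Proof. by rewrite cylinderE; exact: (measurable_coords (@nat_of_ord _) (fun i => [set nth false s i])). Qed.

Let open_cylinder (U : set cantor_space) (x : cantor_space) :
  open U -> U x -> exists2 s, cylinder s x & cylinder s `<=` U.
Proof.
move=> oU Ux; apply: contrapT => noS.
have /choice[y yP] : forall n, exists y : cantor_space,
    (forall i, (i < n)%N -> y i = x i) /\ ~ U y.
  move=> n; apply: contrapT => noy; apply: noS; exists (mkseq x n).
    by move=> i; rewrite size_mkseq => im; rewrite nth_mkseq.
  move=> z; rewrite /cylinder/= size_mkseq => zx; apply: contrapT => nUz.
  by apply: noy; exists z; split=> // i im; rewrite zx// nth_mkseq.
have yx : y @ \oo --> x.
  apply/cvg_sup => i B /= [C [[V oV VC] Cx] CB].
  exists i.+1 => // n /= ni; apply: CB; rewrite -VC /= (yP n).1//.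
  by rewrite -VC in Cx.
have [N _ /(_ N (leqnn N))] := yx _ (open_nbhs_nbhs (conj oU Ux)).
exact: (yP N).2.
Qed.

Let open_bigcup_cylinder (U : set cantor_space) : open U ->
  U = \bigcup_(s : seq bool) (cylinder s `&` [set _ | cylinder s `<=` U]).
Proof.
move=> oU; apply/seteqP; split=> [x /(open_cylinder oU)[s sx sU]|x [s _ [sx]]].
  by exists s.
exact.
Qed.

Let g_sigma_cylinder (G : set (set cantor_borel)) :
  (forall s, G (cylinder s)) -> G `<=` measurable ->
  @measurable _ cantor_borel = <<s G >>.
Proof.
move=> sG Gm; apply/seteqP; split.
  apply: smallest_sub; first exact: smallest_sigma_algebra.
  move=> U oU; rewrite (open_bigcup_cylinder oU).
  apply: (@countable_bigcupT_measurable _ (g_sigma_algebraType G)) => //.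
  move=> s; have [sU|sU] := pselect (cylinder s `<=` U).
    rewrite (_ : _ `&` _ = cylinder s); last by apply/seteqP; split=> [x []|].
    by apply: sub_sigma_algebra; exact: sG.
  rewrite (_ : _ `&` _ = set0); first exact: measurable0.
  by apply/seteqP; split=> [x []|].
by apply: smallest_sub => //; exact: sigma_algebra_measurable.
Qed.

Context {R : realType}.

Let product_measure_cylinder (mu : {measure set cantor_borel -> \bar R}) :
  (forall s, mu (cylinder s) = (2^-1 ^+ size s)%:E) -> is_product_measure mu.
Proof.
move=> mus n A.
pose P s n (A : 'I_n -> set bool) : set cantor_borel := cylinder s `&`
  [set x | forall i : 'I_n, A i (x (size s + i)%N)].
have mP s k (B : 'I_k -> set bool) : measurable (P s k B).
  by apply: measurableI => //; exact: measurable_coords.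
suff H : forall s, mu (P s n A) =
    ((2^-1 ^+ size s)%:E * \prod_(i < n) bernoulli_prob 2^-1 (A i))%E.
  have := H [::]; rewrite expr0 mul1e => <-; congr (mu _).
  by apply/seteqP; split=> [x Ax|x []//]; split=> // i.
elim: n A => [|n IH] A s.
  rewrite big_ord0 mule1 -mus; congr (mu _).
  by apply/seteqP; split=> [x []//|x sx]; split=> // -[].
pose A' i := A (lift ord0 i).
pose Q b : set cantor_borel := [set _ | A ord0 b] `&` P (rcons s b) _ A'.
have PE : P s n.+1 A = Q true `|` Q false.
  apply/seteqP; split=> [x [sx Ax]|x].
    have : Q (x (size s)) x.
      split; first by have := Ax ord0; rewrite addn0.
      split; first by rewrite cylinder_rcons.
      by move=> i; rewrite size_rcons; have := Ax (lift ord0 i);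
        rewrite /= /bump /= add1n addnS addSn.
    by case: (x (size s)); [left|right].
  suff H b : Q b x -> P s n.+1 A x by case=> /H.
  move=> [/= Ab []]; rewrite cylinder_rcons => -[sx xb] Ax; split=> // i.
  have [j ->|->] := unliftP ord0 i; last by rewrite addn0 xb.
  by have := Ax j; rewrite size_rcons /= /bump /= add1n addnS addSn.
have QE b : mu (Q b) = ((2^-1 ^+ (size s).+1)%:E *
    (\d_b (A ord0) * \prod_(i < n) bernoulli_prob 2^-1 (A' i)))%E.
  rewrite diracE; have [/set_mem Ab|/negP nAb] := boolP (b \in A ord0).
    rewrite mul1e (_ : Q b = P (rcons s b) n A').
      by rewrite IH size_rcons.
    by apply/seteqP; split=> [x []|].
  rewrite mul0e mule0 (_ : Q b = set0) ?measure0//.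
  by apply/seteqP; split=> [x [/= Ab]|//]; case: nAb; exact: mem_set.
have mQ b : measurable (Q b).
  have [Ab|nAb] := pselect (A ord0 b).
    by rewrite (_ : Q b = P (rcons s b) n A')//; apply/seteqP; split=> [x []|].
  rewrite (_ : Q b = set0); first exact: measurable0.
  by apply/seteqP; split=> [x []|].
have -> : mu (P s n.+1 A) = (mu (Q true) + mu (Q false))%E.
  rewrite PE measureU//.
  apply/seteqP; split=> // x [[_ [ct _]] [_ [cf _]]]; move: ct cf.
  by rewrite !cylinder_rcons => -[_ /= ->] [].
rewrite !QE big_ord_recl bernoulli_probE; last first.
  by rewrite invr_ge0 ler0n invf_le1 ?ler1n ?ltr0n.
rewrite /= -/A'.
have p0 : (0 <= \prod_(i < n) bernoulli_prob (2^-1 : R) (A' i))%E.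
  by apply: prode_ge0 => i _; exact: measure_ge0.
have -> : unstable.onem (2^-1 : R) = 2^-1 by rewrite /unstable.onem; lra.
have d0 b : (0 <= (\d_b (A ord0) : \bar R))%E by exact: measure_ge0.
rewrite -ge0_muleDr ?mule_ge0// -ge0_muleDl//.
by rewrite -ge0_muleDr// exprSr EFinM -!muleA.
Qed.

(* Existence: the law of the binary digits of a uniform point of [0, 1[. *)
Let digit (x : R) : cantor_space :=
  fun n => odd (Num.truncn (2 ^+ n.+1 * x)).

Let measurable_digit : measurable_fun setT (digit : R -> cantor_borel).
Proof.
have mcoord n : measurable_fun [set: R] (fun x => digit x n).
  apply: (@measurable_fun_bool _ _ _ _ true); rewrite setTI.
  pose c : R := 2 ^+ n.+1; have c0 : 0 < c by rewrite exprn_gt0.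
  rewrite (_ : _ @^-1` _ = \bigcup_(k in [set k : nat | odd k])
     [set` `[k%:R / c, k.+1%:R / c[%R]).
    by apply: bigcup_measurable => k _; exact: measurable_itv.
  apply/seteqP; split=> [x /= ox|x [k /= ok]].
    exists (Num.truncn (c * x)) => //=.
    have cx0 : 0 <= c * x.
      by rewrite leNgt; apply: contraTN ox => /ltW cx0; rewrite /digit
        (_ : Num.truncn _ = 0%N)//; apply/truncn0Pn; rewrite -ltNge
        (le_lt_trans cx0).
    have /andP[h1 h2] := truncn_itv cx0.
    by rewrite in_itv/= ler_pdivrMr// ltr_pdivlMr// (mulrC x) h1 h2.
  rewrite in_itv/= ler_pdivrMr// ltr_pdivlMr// mulrC => xk.
  by rewrite /digit (truncn_def xk).
have sG : @measurable _ cantor_borel = <<s [set C | exists s, C = cylinder s] >>.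
  by apply: g_sigma_cylinder => [s|_ [s ->]//]; exists s.
refine (@measurability _ _ _ cantor_borel setT digit _ sG _).
move=> _ [_ [s ->] <-]; rewrite setTI.
rewrite (_ : _ @^-1` _ = \bigcap_(i in `I_(size s))
    ((fun x => digit x i) @^-1` [set nth false s i])).
  apply: fin_bigcap_measurable => // i _.
  by rewrite -[X in measurable X]setTI; exact: mcoord.
by apply/seteqP; split=> x sx i; exact: sx.
Qed.

Let truncn_double (y : R) : 0 <= y -> (Num.truncn (2 * y))./2 = Num.truncn y.
Proof.
move=> y0; have /andP[h1 h2] := truncn_itv y0.
set k := Num.truncn y in h1 h2 *.
have y20 : 0 <= 2 * y by rewrite mulr_ge0.
have l : (k.*2 <= Num.truncn (2 * y))%N.
  by rewrite truncn_ge_nat// -mul2n natrM ler_pM2l.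
have u : (Num.truncn (2 * y) < k.+1.*2)%N.
  by rewrite truncn_lt_nat// -mul2n natrM ltr_pM2l.
by apply/eqP; rewrite eqn_leq; apply/andP; split; lia.
Qed.

Let code (s : seq bool) := foldl (fun k (b : bool) => k.*2 + b)%N 0%N s.

Let code_lt s : (code s < 2 ^ size s)%N.
Proof.
elim/last_ind: s => [//|s b IH].
by rewrite /code foldl_rcons -/(code s) size_rcons expnS; case: b; lia.
Qed.

Let digit_cylinder (x : R) s : 0 <= x < 1 ->
  cylinder s (digit x) <-> Num.truncn (2 ^+ size s * x) = code s.
Proof.
move=> /andP[x0 x1]; elim/last_ind: s => [|s b IH].
  rewrite expr0 mul1r; split=> // _; apply/truncn0Pn; rewrite -ltNge//.
rewrite cylinder_rcons /code foldl_rcons -/(code s) size_rcons.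
have := @truncn_double (2 ^+ size s * x) (mulr_ge0 (exprn_ge0 _ (ler0n _ 2)) x0).
rewrite mulrA -exprS => h; rewrite -{1}[Num.truncn _]odd_double_half h.
split=> [[/IH -> /= xb]|]; first by rewrite addnC; congr addn; rewrite -xb.
set t := Num.truncn (2 ^+ size s * x) in IH h *.
move=> e; have tb : t = code s /\ odd (Num.truncn (2 ^+ (size s).+1 * x)) = b.
  by move: e; case: b; case: odd => /= e; split=> //; lia.
by split; [apply/IH; case: tb|case: tb].
Qed.

Lemma product_measure_exists :
  exists mu : {measure set cantor_borel -> \bar R}, is_product_measure mu.
Proof.
have mD : measurable (`[0, 1[%classic : set (measurableTypeR R)).
  exact: measurable_itv.
pose nu : {measure set (measurableTypeR R) -> \bar R} :=
  mrestr (@lebesgue_measure R) mD.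
pose mu : {measure set cantor_borel -> \bar R} :=
  measure_function_pushforward__canonical__measure_function_Measure nu measurable_digit.
exists mu; apply: product_measure_cylinder => s.
rewrite /mu/= /pushforward /nu/= /mrestr.
pose c : R := 2 ^+ size s; have c0 : 0 < c by rewrite exprn_gt0.
rewrite (_ : _ `&` _ = [set` `[(code s)%:R / c, (code s).+1%:R / c[%R]).
  rewrite lebesgue_measure_itv/= lte_fin ltr_pM2r ?invr_gt0// ltr_nat ltnSn.
  by rewrite -EFinB -mulrBl -natrB// subSnn mul1r exprVn.
apply/seteqP; split=> [x [sx]|x].
  rewrite /= in_itv/= => /[dup] x01 /andP[x0 _].
  have e := (digit_cylinder s x01).1 sx.
  have := truncn_itv (mulr_ge0 (ltW c0) x0); rewrite e.
  by rewrite in_itv/= ler_pdivrMr// ltr_pdivlMr// mulrC.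
rewrite /= in_itv/= ler_pdivrMr// ltr_pdivlMr// => /andP[h1 h2].
have x0 : 0 <= x by rewrite -(pmulr_lge0 _ c0) (le_trans _ h1).
have x1 : x < 1.
  rewrite -(ltr_pM2r c0) mul1r (lt_le_trans h2)// /c -natrX ler_nat.
  exact: code_lt.
split; last by rewrite /= in_itv/= x0.
by apply/digit_cylinder; [rewrite x0|apply: truncn_def; rewrite mulrC h1].
Qed.

Lemma product_measure_unique (mu nu : {measure set cantor_borel -> \bar R}) :
  is_product_measure mu -> is_product_measure nu ->
  forall A, measurable A -> mu A = nu A.
Proof.
move=> muP nuP A mA.
pose G : set (set cantor_borel) := [set C | exists n (B : 'I_n -> set bool),
  C = [set x : cantor_borel | forall i, B i (x i)]].
have GT : G setT.
  by exists 0%N, (fun=> setT); apply/seteqP; split.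
apply: (@measure_unique _ _ _ G (fun=> setT)) => //.
- apply: g_sigma_cylinder => [s|_ [n [B ->]]]; last exact: measurable_coords.
  by exists (size s), (fun i => [set nth false s i]); rewrite cylinderE.
- move=> _ _ [n [B ->]] [m [C ->]].
  exists (maxn n m), (fun k => [set b |
    (forall i : 'I_n, i = k :> nat -> B i b) /\
    (forall i : 'I_m, i = k :> nat -> C i b)]).
  apply/seteqP; split=> [x [Bx Cx] k|x BCx].
    by split=> i <-; [exact: Bx|exact: Cx].
  split=> i.
    have lt : (i < maxn n m)%N by rewrite leq_max ltn_ord.
    exact: (BCx (Ordinal lt)).1.
  have lt : (i < maxn n m)%N by rewrite leq_max ltn_ord orbT.
  exact: (BCx (Ordinal lt)).2.
- by apply/seteqP; split=> // x _; exists 0%N.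
- by move=> _ [n [B ->]]; rewrite muP nuP.
- move=> _; have := muP 0%N (fun=> setT); rewrite big_ord0.
  rewrite (_ : [set _ | _] = setT) => [->|]; first exact: ltry.
  by apply/seteqP; split=> // x _ [].
Qed.

End product_measure.

(* Determined on all Borel sets, by [product_measure_unique]. *)
Definition cantor_measure (R : realType) :
    {measure set cantor_borel -> \bar R} :=
  sval (cid (@product_measure_exists R)).

Lemma cantor_measureP (R : realType) : is_product_measure (cantor_measure R).
Proof. exact: svalP. Qed.

(* Main.v *)
(* Fix a nonprincipal ultrafilter D on nat and open sets P i such that the points
   lying in P i for all large i are dense. The set of the x with x in P i for
   D-many i is contained in the limsup of the P i, hence null by Borel-Cantelli
   as soon as the measures of the P i are summable. It is not meager: given
   nowhere dense sets F n, one builds two points at once along a sequence of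
   consecutive blocks of indices; on even blocks the first point is moved away
   from the next F n while the second is kept in every P i of the block, and on
   odd blocks the roles are exchanged. As D is an ultrafilter, the union of the
   even blocks or that of the odd blocks belongs to D (up to a finite set), so
   one of the two points is in the set, and neither is in any F n.
   In the Cantor space P i is the subgroup of the x vanishing on [i, 2i). In the
   reals P i is the (c + 1) / 4^i-neighbourhood of the multiples of 1 / 2^i, with
   a union over c to make the set closed under differences. *)
Require Import Defs.
From HB Require Import structures.
From mathcomp Require Import all_boot all_order all_algebra.
From mathcomp Require Import all_classical all_reals all_analysis.
From mathcomp Require Import measurable_realfun.
From mathcomp Require Import zify ring lra.

Set Implicit Arguments.
Unset Strict Implicit.
Unset Printing Implicit Defensive.

Import Order.TTheory GRing.Theory Num.Theory.
Import numFieldNormedType.Exports.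

Local Open Scope classical_set_scope.
Local Open Scope ring_scope.

(** * Topology: shrinking neighbourhoods and points of nested sets *)

Lemma locally_compact_regular_shrink (T : topologicalType) (U : set T) (x : T) :
  regular_space T -> locally_compact [set: T] -> open U -> U x ->
  exists V, [/\ open V, V x, compact (closure V) & closure V `<=` U].
Proof.
move=> regT lcT oU Ux.
have [K] := lcT x I; rewrite withinET => Kx [cK clK].
have [B Bx BU] := regT x (U `&` K) (filterI (open_nbhs_nbhs (conj oU Ux)) Kx).
have sB : closure B° `<=` U `&` K.
  by apply: subset_trans BU; apply: closureS; exact: interior_subset.
exists B°; split => //.
- exact: open_interior.
- by apply: (@subclosed_compact _ _ K) => [|//|y /sB[]//]; exact: closed_closure.
- by move=> y /sB[].
Qed.

(** A cluster point of any selection from the [K n] lies in each closure, hence in each [K n].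
    Compact closures are asked for only cofinally because the construction below shrinks each
    neighbourhood in this way only at every other step. *)
Lemma nested_compact_nonempty (T : topologicalType) (K : (set T)^nat) :
  (forall n, K n !=set0) -> (forall n, K n.+1 `<=` K n) ->
  (forall n, exists m, (n <= m)%N /\ compact (closure (K m))
     /\ closure (K m) `<=` K n) ->
  exists x, forall n, K n x.
Proof.
move=> K0 Kdec Kc.
have Kle n m : (n <= m)%N -> K m `<=` K n.
  move=> /subnKC <-; elim: (m - n)%N => [|k IH]; first by rewrite addn0.
  by rewrite addnS; apply: subset_trans IH; exact: Kdec.
have [f fK] := choice K0.
have evK n : (f @ \oo) (K n).
  by exists n => // i /= ni; exact: Kle (fK i).
have [m [_ [cK _]]] := Kc 0%N.
have [|x [_ xf]] := cK (f @ \oo) _ _.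
  exact: filterS (@subset_closure _ _) (evK m).
exists x => n; have [k [nk [_ kn]]] := Kc n.
by apply: kn => A Ax; exact: xf (evK k) Ax.
Qed.

Lemma open_forall_range (T : topologicalType) (P : (set T)^nat) (m n : nat) :
  (forall i, open (P i)) -> open [set x | forall i, (m <= i < n)%N -> P i x].
Proof.
move=> oP; elim: n => [|n IH].
  suff -> : [set x | forall i, (m <= i < 0)%N -> P i x] = setT by exact: openT.
  by apply/seteqP; split=> // x _ i; rewrite ltn0 andbF.
have [nm|mn] := ltnP n m.
  suff -> : [set x | forall i, (m <= i < n.+1)%N -> P i x] = setT.
    exact: openT.
  apply/seteqP; split=> // x _ i.
  by rewrite ltnS => /andP[mi /(leq_trans mi)]; rewrite leqNgt nm.
rewrite (_ : [set _ | _] =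
    [set x | forall i, (m <= i < n)%N -> P i x] `&` P n); first exact: openI.
apply/seteqP; split=> [x Zx|x [Zx Px] i /andP[mi]].
  split; last by apply: Zx; rewrite mn ltnSn.
  by move=> i /andP[mi im]; apply: Zx; rewrite mi ltnW.
by rewrite ltnS leq_eqVlt => /predU1P[->//|im]; apply: Zx; rewrite mi.
Qed.

(** * Non-meagerness by the two-point construction *)

Lemma ultrafilter_nonmeager (T : topologicalType) (D : set_system nat)
    (P : (set T)^nat) : UltraFilter D -> \oo `<=` D ->
  regular_space T -> locally_compact [set: T] -> [set: T] !=set0 ->
  (forall i, open (P i)) ->
  (forall U, open U -> U !=set0 ->
     exists x m, U x /\ forall i, (m <= i)%N -> P i x) ->
  ~ meager [set x | D [set i | P i x]].
Proof.
move=> uD ooD regT lcT T0 oP dP [F [Fnd GF]].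
(* A neighbourhood for each of the two points, and the start of the next block. *)
pose state := ((bool -> set T) * nat)%type.
(* The witness [p] lies in all later [P i], so cutting the neighbourhood down by a block condition
   never empties it. *)
pose inv (s : state) := forall b, open (s.1 b) /\
  exists2 p, s.1 b p & forall i, (s.2 <= i)%N -> P i p.
pose Z m m' := [set x | forall i, (m <= i < m')%N -> P i x].
have oZ m m' : open (Z m m') by exact: open_forall_range.
(* Point [odd k] escapes while the other is kept in the block. Since [k./2] is [n] at both steps 2n
   and 2n+1, each point escapes every [F n]. *)
pose step k (s s' : state) := let b := odd k in
  [/\ (s.2 < s'.2)%N, compact (closure (s'.1 b)),
      closure (s'.1 b) `<=` s.1 b `\` closure (F k./2) &
      s'.1 (~~ b) `<=` s.1 (~~ b) `&` Z s.2 s'.2].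
have exstep (ks : nat * {s | inv s}) :
    exists s' : {s | inv s}, step ks.1 (sval ks.2) (sval s').
  case: ks => k [[U m] /= invU]; set b := odd k.
  have [oU [p Up _]] := invU b; have [oW [q Wq Pq]] := invU (~~ b).
  have [p1 [Up1 Fp1]] : (U b `\` closure (F k./2)) !=set0.
    apply: contrapT => /nonemptyPn UF0.
    suff : (closure (F k./2))° p by rewrite (Fnd k./2).
    apply: filterS (open_nbhs_nbhs (conj oU Up)) => y Uy.
    by apply: contrapT => Fy; have : set0 y by rewrite -UF0; split.
  have oUF : open (U b `\` closure (F k./2)).
    by apply: openI => //; rewrite openC; exact: closed_closure.
  have [V [oV Vp1 cV VU]] :=
    locally_compact_regular_shrink regT lcT oUF (conj Up1 Fp1).
  have [p2 [m2 [Vp2 Pp2]]] := dP V oV (ex_intro _ p1 Vp1).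
  (* [m2] restores the invariant for the new witness [p2]; [m.+1] makes the block nonempty. *)
  pose m' := maxn m2 m.+1.
  pose U' c := if c == b then V else U (~~ b) `&` Z m m'.
  have U'b : U' b = V by rewrite /U' eqxx.
  have U'nb : U' (~~ b) = U (~~ b) `&` Z m m'.
    by rewrite /U'; case: (b).
  have invU' : inv (U', m').
    move=> c /=; have [->|->] : c = b \/ c = ~~ b.
    - by case: (c) (b) => -[]; [left|right|right|left].
    - rewrite U'b; split=> //; exists p2 => // i m'i; apply: Pp2.
      by rewrite (leq_trans _ m'i)// leq_maxl.
    - rewrite U'nb; split; first exact: openI.
      exists q => [|i m'i]; first by split=> // i /andP[+ _]; exact: Pq.
      by apply: Pq; rewrite (leq_trans _ m'i)// ltnW// leq_max ltnSn orbT.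
  exists (exist _ (U', m') invU'); rewrite /step /= -/b U'b U'nb.
  by split=> //; rewrite /m' leq_max ltnSn orbT.
have [f fP] := choice exstep.
have [p0 [m0 [_ Pp0]]] := dP setT openT T0.
have inv0 : inv ((fun=> setT), m0).
  by move=> b /=; split; [exact: openT|exists p0].
pose s := fix s k := if k is k'.+1 then f (k', s k') else exist inv _ inv0.
pose S b k := (sval (s k)).1 b.
pose m k := (sval (s k)).2.
have sP k : step k (sval (s k)) (sval (s k.+1)) := fP (k, s k).
have Sdec b k : S b k.+1 `<=` S b k.
  have [_ _ h1 h2] := sP k; have [->|->] : b = odd k \/ b = ~~ odd k.
  - by case: (b) (odd k) => -[]; [left|right|right|left].
  - by move=> x Sx; have [] := h1 x (subset_closure Sx).
  - by move=> x /h2[].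
have /choice[x xS] : forall b, exists x, forall k, S b k x.
  move=> b; apply: nested_compact_nonempty => // [k|k].
    by have [_ [p]] := svalP (s k) b; exists p.
  (* The first step from [k] on at which point [b] is the one that escapes. *)
  pose j := if odd k == b then k else k.+1.
  have kj : (k <= j)%N by rewrite /j; case: ifP.
  have jb : odd j = b.
    by rewrite /j; case: ifPn => [/eqP//|/=]; case: (odd k) (b) => -[].
  exists j.+1; have [_ h1 h2 _] := sP j; rewrite jb in h1 h2.
  split; first exact: ltnW.
  split=> // y /h2[Sy _]; move: Sy; rewrite -/(S b j) /j.
  by case: ifP => // _; exact: Sdec.
have notF b n : ~ F n (x b).
  (* This index has parity [b] and half [n]: there, point [b] escapes [F n]. *)
  move=> Fx; have [_ _ h _] := sP (b + n.*2)%N.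
  have := h (x b); rewrite oddD odd_double addbF half_bit_double oddb.
  by case/(_ (subset_closure (xS b _))) => _; apply; exact: subset_closure.
(* The union of the blocks during which point [b] escapes, so that the other point lies in [P i] for
   all [i] in [E b]. *)
pose E b := [set i | exists2 k, odd k = b & (m k <= i < m k.+1)%N].
have EP b i : E (~~ b) i -> P i (x b).
  case=> k kb ki; have [_ _ _] := sP k; rewrite kb negbK.
  by case/(_ _ (xS b _)) => _ /(_ i ki).
have EU i : (m0 <= i)%N -> E true i \/ E false i.
  move=> m0i; suff [k ki] : exists k, (m k <= i < m k.+1)%N.
    by case ok: (odd k); [left|right]; exists k.
  have mS k : (m k < m k.+1)%N by have [] := sP k.
  have mk k : (k <= m k)%N by elim: k => // k IH; exact: leq_ltn_trans (mS k).
  have exk : exists k, (i < m k)%N by exists i.+1.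
  (* The least [k] with [i < m k] is positive because [m 0] is [m0]; its predecessor names the block
     of [i]. *)
  case: (ex_minnP exk) => -[|k] ik kmin; first by rewrite ltnNge m0i in ik.
  by exists k; rewrite ik andbT leqNgt; apply/negP => /kmin; rewrite ltnn.
have [b Eb] : exists b, D (E (~~ b)).
  have [Ef|nEf] := in_ultra_setVsetC (E false) uD; first by exists true.
  exists false; apply: (@filterS _ D _ ([set i | (m0 <= i)%N] `&` ~` E false)).
    by move=> i [/EU[]].
  by apply: filterI => //; apply: ooD; exists m0.
have [n _] := GF (x b) (filterS (@EP b) Eb).
exact: notF.
Qed.

(** * Nullity by Borel-Cantelli, and the ultrafilter *)

Lemma ultrafilter_negligible d (T : measurableType d) (R : realType)
    (mu : {measure set T -> \bar R}) (D : set_system nat) (P : (set T)^nat) :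
  UltraFilter D -> \oo `<=` D -> (forall i, measurable (P i)) ->
  (\sum_(i <oo) mu (P i) < +oo)%E ->
  mu.-negligible [set x | D [set i | P i x]].
Proof.
move=> uD ooD mP Poo; exists (lim_sup_set P); split.
- apply: bigcap_measurable => [|n _]; first by exists 0%N.
  exact: bigcup_measurable.
- exact: lim_sup_set_cvg0.
- move=> x Dx n _.
  have Dn : D [set i | (n <= i)%N] by apply: ooD; exists n.
  by have [i [Pi ni]] := filter_ex (filterI Dx Dn); exists i.
Qed.

Lemma nneseries_geometric_lty (R : realType) (u : (\bar R)^nat) (C : R) :
  (forall i, (0 <= u i)%E) -> (forall i, (u i <= (C / 2 ^+ i)%:E)%E) ->
  (\sum_(i <oo) u i < +oo)%E.
Proof.
move=> u0 uC.
have C0 : 0 <= C.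
  by have := le_trans (u0 0%N) (uC 0%N); rewrite lee_fin expr0 divr1.
(* [epsilon_trick0] has terms e / 2 ^ i.+1; e = 2 * C turns them into C / 2 ^ i. *)
apply: (@le_lt_trans _ _ (2 * C)%:E); last exact: ltry.
apply: le_trans (epsilon_trick0 predT (mulr_ge0 (ler0n R 2) C0)).
apply: lee_nneseries => // i _; rewrite (le_trans (uC i))// lee_fin.
by rewrite natrX exprS invfM mulrACA divff ?mul1r// pnatr_eq0.
Qed.

Lemma exists_nonprincipal_ultrafilter :
  exists2 D : set_system nat, UltraFilter D & \oo `<=` D.
Proof.
by have [D [uD ooD]] := @ultraFilterLemma nat \oo _; exists D.
Qed.

(** * The subgroup of the Cantor space *)

Lemma cantor_space_locally_compact : locally_compact [set: cantor_space].
Proof.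
move=> x _; rewrite withinET; exists setT; first exact: filterT.
by split; [exact: cantor_space_compact|exact: closedT].
Qed.

Lemma open_cantor_coord (k : nat) (B : set bool) :
  open [set x : cantor_space | B (x k)].
Proof.
have -> : [set x : cantor_space | B (x k)] =
    (@proj _ (fun _ : nat => bool) k) @^-1` B by [].
apply: open_comp; first by move=> + _; exact: proj_continuous.
exact: discrete_open.
Qed.

(** Provides the density hypothesis: the truncation at [n] lies in [zero_block i] for all i >= n. *)
Lemma cantor_truncation_cvg (x : cantor_space) :
  (fun j => (j < n)%N && x j : bool) @[n --> \oo] --> (x : cantor_space).
Proof.
apply/cvg_sup => i B /= [C [[V oV VC] Cx] CB].
exists i.+1 => // n /= ni; apply: CB; rewrite -VC /= /proj ni.
by rewrite -VC in Cx.
Qed.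

(** Length [i] makes the measures summable; starting at [i] puts every finitely supported sequence
    in almost all of these sets. *)
Definition zero_block (i : nat) : set cantor_space :=
  [set x | forall j, (i <= j < i + i)%N -> x j = false].

Lemma open_zero_block i : open (zero_block i).
Proof.
by apply: open_forall_range => j; exact: (open_cantor_coord j [set false]).
Qed.

Lemma cantor_measure_zero_block (R : realType) i :
  cantor_measure R (zero_block i) = (1 / 2 ^+ i)%:E.
Proof.
pose A (k : 'I_(i + i)) := if (i <= k)%N then [set false] else setT.
have -> : zero_block i = [set x : cantor_borel | forall k, A k (x k)].
  apply/seteqP; split=> [x zx k|x Ax j /andP[ij ji]].
    rewrite /A; case: ifP => // ik; apply: zx; by rewrite ik ltn_ord.
  by have := Ax (Ordinal ji); rewrite /A /= ij.
(* The first [i] coordinates are free and contribute 1, the last [i] contribute 1/2 each. *)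
rewrite (cantor_measureP R) big_split_ord/= big1 => [|k _]; last first.
  by rewrite /A /= leqNgt ltn_ord probability_setT.
rewrite mul1e (eq_bigr (fun=> (2^-1 : R)%:E)) => [|k _].
  by rewrite prodEFin prodr_const card_ord exprVn mul1r.
rewrite /A /= leq_addr bernoulli_probE; last by lra.
rewrite !diracE (memNset _) ?mem_set//= mule0 add0e mule1.
by congr EFin; rewrite /unstable.onem; lra.
Qed.

Lemma cantor_null_nonmeager_subgroup (R : realType) :
  exists G : set cantor_space,
     [/\ GRing.zmod_closed (mem G),
         (cantor_measure R).-negligible G &
         ~ meager G].
Proof.
have [D uD ooD] := exists_nonprincipal_ultrafilter.
exists [set x | D [set i | zero_block i x]]; split.
- split; first by rewrite inE; apply: filterS filterT => i _.
  move=> x y; rewrite !inE /= => Dx Dy.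
  apply: filterS (filterI Dx Dy) => i [xi yi] j ij.
  have -> : (x - y) j = x j (+) y j by [].
  by rewrite xi// yi.
- apply: ultrafilter_negligible => //.
    by move=> i; apply: sub_sigma_algebra; exact: open_zero_block.
  apply: (@nneseries_geometric_lty _ _ 1) => // i.
  by rewrite cantor_measure_zero_block.
- apply: ultrafilter_nonmeager => //.
  + exact: uniform_regular.
  + exact: cantor_space_locally_compact.
  + by exists point.
  + exact: open_zero_block.
  move=> U oU [x Ux].
  have [n _ /(_ n (leqnn n)) Un] :=
    cantor_truncation_cvg (open_nbhs_nbhs (conj oU Ux)).
  exists (fun j => (j < n)%N && x j), n; split=> // i ni j /andP[ij _].
  by rewrite ltnNge (leq_trans ni ij).
Qed.

(** * The subgroup of the reals *)

Definition near_dyadic (R : realType) (c i : nat) : set R :=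
  \bigcup_(z : int) ball (z%:~R / 2 ^+ i : R) (c.+1%:R / 4 ^+ i).

Lemma near_dyadicP (R : realType) (c i : nat) (x : R) :
  near_dyadic c i x <->
  exists z : int, `|z%:~R / 2 ^+ i - x| < c.+1%:R / 4 ^+ i.
Proof. by split=> [[z _ zx]|[z zx]]; exists z. Qed.

Lemma open_near_dyadic (R : realType) (c i : nat) : open (@near_dyadic R c i).
Proof. by apply: bigcup_open => z _; exact: ball_open. Qed.

(** Multiples of 1 / 2 ^ i form a group and the radii add up: c.+1 + c'.+1 = (c + c').+2. *)
Lemma near_dyadicB (R : realType) (c c' i : nat) (x y : R) :
  near_dyadic c i x -> near_dyadic c' i y -> near_dyadic (c + c').+1 i (x - y).
Proof.
move=> /near_dyadicP[z zx] /near_dyadicP[t ty]; apply/near_dyadicP.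
exists (z - t).
have -> : (z - t)%:~R / 2 ^+ i - (x - y) =
    (z%:~R / 2 ^+ i - x) - (t%:~R / 2 ^+ i - y) by rewrite intrB; ring.
apply: (le_lt_trans (ler_normB _ _)); apply: (lt_le_trans (ltrD zx ty)).
by rewrite -mulrDl -natrD addSn addnS.
Qed.

(** About 2 ^ i centres per unit length with radii of order 1 / 4 ^ i leave measure of order 1 / 2 ^
    i. *)
Lemma lebesgue_measure_near_dyadic (R : realType) (c N i : nat) :
  (lebesgue_measure (@near_dyadic R c i `&` ball (0 : R) N%:R)%R <=
   (((2 * (N + c.+1)).+1 * c.+1 * 2)%:R / 2 ^+ i)%:E)%E.
Proof.
(* Bounds [|z|] for every ball meeting the interval, as its centre is within N + c.+1 / 2 ^ i of
   0. *)
pose K := (N * 2 ^ i + c.+1)%N.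
pose r : R := c.+1%:R / 4 ^+ i.
(* The shift by [K] indexes the centres from -K to K by naturals. *)
pose A k : set (measurableTypeR R) := ball ((k%:R - K%:R) / 2 ^+ i : R) r.
have p2 : 0 < 2 ^+ i :> R by rewrite exprn_gt0.
have p4 : 0 < 4 ^+ i :> R by rewrite exprn_gt0.
have r0 : 0 <= r by rewrite divr_ge0// ltW.
have mA k : measurable (A k) by exact: measurable_ball.
have e4 : 4 ^+ i = 2 ^+ i * 2 ^+ i :> R by rewrite -exprMn -natrM.
apply: (@le_trans _ _ (lebesgue_measure (\big[setU/set0]_(k < (2 * K).+1) A k))).
  apply: le_measure; rewrite ?inE.
  - apply: measurableI; last exact: measurable_ball.
    by apply: open_measurable; exact: open_near_dyadic.
  - by apply: bigsetU_measurable => k _.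
  move=> x [/near_dyadicP[z zx]]; rewrite -ball_normE /ball_ /= sub0r normrN => xN.
  have zK : `|z%:~R : R| <= K%:R.
    have h : `|z%:~R / 2 ^+ i : R| < N%:R + c.+1%:R / 2 ^+ i.
      rewrite -[X in `|X|](subrK x); apply: (le_lt_trans (ler_normD _ _)).
      rewrite addrC ltrD// (lt_le_trans zx)// ler_pM2l ?ltr0n//.
      rewrite lef_pV2 ?posrE// lerXn2r ?nnegrE//.
      by rewrite ler_nat.
    move: h; rewrite normrM normfV (gtr0_norm p2) ltr_pdivrMr// mulrDl divfK ?gt_eqF//.
    by move=> /ltW; rewrite /K natrD natrM natrX.
  have zK' : (`|z| <= K)%N by move: zK; rewrite -intr_norm [K%:R]pmulrn ler_int; lia.
  pose k := absz (z + K%:Z).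
  have kE : k%:Z = z + K%:Z by rewrite /k; lia.
  have kK : (k < (2 * K).+1)%N by lia.
  rewrite -(bigcup_mkord _ A); exists k => //=.
  rewrite /A -ball_normE /ball_ /=.
  by rewrite [k%:R]pmulrn kE intrD -[K%:Z%:~R]pmulrn addrK.
apply: (le_trans (Boole_inequality _ _)) => [k _//|].
rewrite (eq_bigr (fun=> (r *+ 2)%:E)) => [|k _]; last first.
  exact: lebesgue_measure_ball.
rewrite sumEFin sumr_const card_ord lee_fin -mulr_natr -[r *+ 2]mulr_natr /r e4.
have hK : (2 * K).+1%:R <= (2 * (N + c.+1)).+1%:R * 2 ^+ i :> R.
  rewrite -natrX -natrM ler_nat /K.
  have := expn_gt0 2 i; move: (2 ^ i)%N => a /= a0; nia.
rewrite !natrM invfM.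
set a := (2 * K).+1%:R in hK *; set b := (2 * (N + c.+1)).+1%:R in hK *.
rewrite [leLHS](_ : _ = (a / 2 ^+ i) * (c.+1%:R * 2 / 2 ^+ i)); last by ring.
rewrite [leRHS](_ : _ = b * (c.+1%:R * 2 / 2 ^+ i)); last by ring.
apply: ler_wpM2r; first by rewrite divr_ge0 ?mulr_ge0// ltW.
by rewrite ler_pdivrMr.
Qed.

Lemma real_null_nonmeager_subgroup (R : realType) :
  exists G : set R,
     [/\ GRing.zmod_closed (mem G),
         (@lebesgue_measure R).-negligible G &
         ~ meager G].
Proof.
have [D uD ooD] := exists_nonprincipal_ultrafilter.
pose G c : set R := [set x | D [set i | near_dyadic c i x]].
exists (\bigcup_c G c); split.
- split.
    rewrite inE; exists 0%N => //; apply: filterS filterT => i _.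
    by apply/near_dyadicP; exists 0; rewrite mul0r subr0 normr0 divr_gt0// exprn_gt0.
  move=> x y; rewrite !inE /= => -[c _ Dx] [c' _ Dy]; exists (c + c').+1 => //.
  by apply: filterS (filterI Dx Dy) => i [xi yi]; exact: near_dyadicB.
- apply: negligible_bigcup => c.
  (* Summability holds only on bounded parts, so the set is cut by balls of radius [N]. *)
  pose Q N i : set (measurableTypeR R) := near_dyadic c i `&` ball (0 : R) N%:R.
  apply: (@negligibleS _ _ _ _ (\bigcup_N [set x | D [set i | Q N i x]])).
    move=> x Dx; exists (Num.truncn `|x|).+1 => //=.
    apply: filterS Dx => i xi; split=> //.
    by rewrite -ball_normE /ball_ /= sub0r normrN truncnS_gt.
  apply: negligible_bigcup => N; apply: ultrafilter_negligible => //.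
    move=> i; apply: measurableI; last exact: measurable_ball.
    by apply: open_measurable; exact: open_near_dyadic.
  apply: nneseries_geometric_lty => // i; exact: lebesgue_measure_near_dyadic.
(* A superset of a non-meager set is non-meager, so [c] = 0 suffices. *)
- have nG0 : ~ meager (G 0%N).
    apply: ultrafilter_nonmeager => //.
    + exact: uniform_regular.
    + exact: locally_compactR.
    + by exists 0.
    + exact: open_near_dyadic.
    move=> U oU [x Ux].
    have [e /= e0 eU] := (nbhs_ballP x U).1 (open_nbhs_nbhs (conj oU Ux)).
    pose m := (Num.truncn e^-1).+1.
    have p2 k : 0 < 2 ^+ k :> R by rewrite exprn_gt0.
    have me : (2 ^+ m)^-1 < e.
      rewrite invf_plt ?posrE// (lt_le_trans (truncnS_gt _))//.
      by rewrite -natrX ler_nat ltnW// ltn_expl.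
    (* Rounding down to a multiple of 1 / 2 ^ m moves [x] by less than [e], and such a multiple is
       also one of 1 / 2 ^ i for i >= m. *)
    pose z := Num.floor (2 ^+ m * x).
    exists (z%:~R / 2 ^+ m), m; split.
      apply: eU; rewrite -ball_normE /ball_ /=; apply: le_lt_trans me.
      have /andP[z1 z2] := floor_itv (2 ^+ m * x); rewrite -/z in z1 z2.
      have -> : x - z%:~R / 2 ^+ m = (2 ^+ m * x - z%:~R) / 2 ^+ m.
        by field; rewrite gt_eqF.
      rewrite normrM normfV (gtr0_norm (p2 m)) ler_piMl ?invr_ge0 ?ltW//.
      by rewrite ger0_norm ?subr_ge0//; rewrite intrD in z2; lra.
    move=> i mi; apply/near_dyadicP; exists (z * 2 ^+ (i - m)).
    have -> : (z * 2 ^+ (i - m))%:~R / 2 ^+ i = z%:~R / 2 ^+ m :> R.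
      rewrite -{2}(subnK mi) exprD intrM rmorphXn/=.
      by field; rewrite !gt_eqF.
    by rewrite subrr normr0 divr_gt0// exprn_gt0.
  move=> [F [Fnd GF]]; apply: nG0; exists F; split=> // x Gx.
  by apply: GF; exists 0%N.
Qed.

Theorem theorem2p3 (R : realType) :
  (exists G : set cantor_space,
     [/\ GRing.zmod_closed (mem G),
         (cantor_measure R).-negligible G &
         ~ meager G]) /\
  (exists G : set R,
     [/\ GRing.zmod_closed (mem G),
         (@lebesgue_measure R).-negligible G &
         ~ meager G]).
Proof.
split; [exact: cantor_null_nonmeager_subgroup|].
exact: real_null_nonmeager_subgroup.
Qed.
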